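(* Let $P$ be a finite poset and let $Q=\{q_1<q_2<\cdots<q_r\}$ ($r\ge 1$) be a chain in $P$. Let $\hat P$ be obtained from $P$ by adjoining a new minimum $\hat 0$ and a new maximum $\hat 1$, and put $q_0=\hat 0$, $q_{r+1}=\hat 1$. Then the set $M_{P,Q}$ is exactly the set of integer lattice points of the generalized permutohedron $$N_{P,Q}=\sum_{1\le i\le j\le r+1}|B_{i,j}|\,\Delta_{[i,j]}\subset\mathbb{R}^{r+1}.$$
   Context: A linear extension of a finite poset $X$ is a bijection $\sigma:X\to\{1,\dots,|X|\}$ with $x<y\Rightarrow\sigma(x)<\sigma(y)$. The $(P,Q)$-subposet vectors are the vectors $(\sigma(q_1),\dots,\sigma(q_r))\in\mathbb{Z}^r$, where $\sigma$ ranges over linear extensions of $\hat P$. $M_{P,Q}\subset\mathbb{Z}^{r+1}$ is the set of vectors $(c_1,c_2-c_1,\dots,c_r-c_{r-1},|\hat P|-c_r)$ with $(c_1,\dots,c_r)$ a $(P,Q)$-subposet vector. All order relations below are in $\hat P$. Define $B_{1,1}=\{p:q_0\le p\le q_1\}$, $B_{i,i}=\{p:q_{i-1}<p\le q_i\}$ for $2\le i\le r+1$, and for $1\le i<j\le r+1$, $B_{i,j}=\{p: q_{i-1}<p<q_j,\ q_i\not\le p,\ p\not\le q_{j-1}\}$. For $1\le i\le j\le r+1$, $\Delta_{[i,j]}=\mathrm{conv}(e_i,\dots,e_j)\subset\mathbb{R}^{r+1}$. For an integer $c\ge 0$, $c\Delta$ is the dilation of $\Delta$ by $c$ ($0\Delta=\{0\}$),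 and the sum is the Minkowski sum. Integer lattice points are points of $\mathbb{Z}^{r+1}$. *)

(* Defs.v *)
From HB Require Import structures.
From mathcomp Require Import all_boot all_order all_algebra.
From mathcomp Require Import boolp classical_sets reals convex.

Set Implicit Arguments.
Unset Strict Implicit.
Unset Printing Implicit Defensive.

Import Order.TTheory GRing.Theory Num.Theory.

Local Open Scope classical_set_scope.
Local Open Scope ring_scope.

(* hat P is the poset P with a new minimum and a new maximum adjoined. *)
Inductive hat (P : Type) : predArgType := HatBot | HatIn of P | HatTop.
Arguments HatBot {P}.
Arguments HatTop {P}.

Section HatOrder.
Context {d : Order.disp_t} {P : finPOrderType d}.

Definition option_of_hat (x : hat P) : option (option P) :=
  match x with
  | HatBot => None
  | HatIn p => Some (Some p)
  | HatTop => Some None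
  end.

Definition hat_of_option (x : option (option P)) : hat P :=
  match x with
  | None => HatBot
  | Some (Some p) => HatIn p
  | Some None => HatTop
  end.

Lemma option_of_hatK : cancel option_of_hat hat_of_option.
Proof. by case. Qed.

HB.instance Definition _ := Equality.copy (hat P) (can_type option_of_hatK).
HB.instance Definition _ := Choice.copy (hat P) (can_type option_of_hatK).
HB.instance Definition _ := Countable.copy (hat P) (can_type option_of_hatK).
HB.instance Definition _ := Finite.copy (hat P) (can_type option_of_hatK).

Definition le_hat (x y : hat P) : bool :=
  match x, y with
  | HatBot, _ => true
  | _, HatTop => true
  | HatIn p, HatIn p' => (p <= p')%O
  | _, _ => false
  end.

Lemma le_hat_refl : reflexive le_hat.
Proof. by case=> //= p; exact: lexx. Qed.

Lemma le_hat_anti : antisymmetric le_hat.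
Proof. by case=> [|p|] [|p'|] //= /le_anti ->. Qed.

Lemma le_hat_trans : transitive le_hat.
Proof. by case=> [|p|] [|p'|] [|p''|] //=; exact: le_trans. Qed.

HB.instance Definition _ :=
  Order.Le_isPOrder.Build d (hat P) le_hat_refl le_hat_anti le_hat_trans.

Lemma le_hat0x (x : hat P) : (HatBot <= x)%O. Proof. by []. Qed.

Lemma le_hatx1 (x : hat P) : (x <= HatTop)%O. Proof. by case: x. Qed.

HB.instance Definition _ := Order.hasBottom.Build d (hat P) le_hat0x.
HB.instance Definition _ := Order.hasTop.Build d (hat P) le_hatx1.

End HatOrder.

(* The sequence a, f_1, ..., f_r, b, indexed by 0, ..., r+1 (and constantly b
   afterwards); f_k is the value of f at the ordinal k - 1. *)
Definition with_ends (T : Type) (r : nat) (a b : T) (f : 'I_r -> T) (k : nat) :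
    T :=
  if k is k'.+1 then (if insub k' is Some i then f i else b) else a.

(* Labels are taken in {0, ..., #|X| - 1}: the usual label of x is
   (s x).+1. *)
Definition linear_extension d (X : finPOrderType d) (s : X -> 'I_#|X|) : Prop :=
  bijective s /\ {homo s : x y / (x < y)%O >-> (x < y)%N}.

Section SubposetVectors.
Context {d : Order.disp_t} {P : finPOrderType d} {r : nat}.
Variable q : 'I_r -> P.

Definition subposet_vectors : set 'rV[int]_r :=
  [set c | exists2 s : hat P -> 'I_#|hat P|, linear_extension s &
           c = \row_i ((s (HatIn (q i))).+1)%:Z].

(* (c_1, c_2 - c_1, ..., c_r - c_(r-1), #|hat P| - c_r) *)
Definition gap_vector (c : 'rV[int]_r) : 'rV[int]_r.+1 :=
  \row_(k < r.+1) (with_ends 0 (#|hat P|)%:Z (c 0) k.+1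
                   - with_ends 0 (#|hat P|)%:Z (c 0) k).

Definition M_PQ : set 'rV[int]_r.+1 := gap_vector @` subposet_vectors.

(* q_0 = bottom, q_1, ..., q_r, q_(r+1) = top *)
Definition qhat (k : nat) : hat P :=
  with_ends \bot%O \top%O (fun i => HatIn (q i)) k.

(* The ordinals i, j < r+1 stand for the 1-based indices i+1, j+1, so that
   qhat i is q_(i-1) and qhat i.+1 is q_i in 1-based numbering. *)
Definition B_PQ (i j : 'I_r.+1) : {set hat P} :=
  if i == j then
    if i == ord0 then [set p | (qhat 0 <= p <= qhat 1)%O]%SET
    else [set p | (qhat i < p <= qhat i.+1)%O]%SET
  else [set p | [&& (qhat i < p < qhat j.+1)%O,
                    ~~ (qhat i.+1 <= p)%O & ~~ (p <= qhat j)%O]]%SET.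

End SubposetVectors.
Arguments gap_vector {d} P {r} c.

Section Polytopes.
Context {R : realType}.

Definition convex_hull (V : lmodType R) (A : set V) : set V :=
  smallest (@convex_set R V) A.

Definition dilate (V : lmodType R) (c : nat) (A : set V) : set V :=
  [set c%:R *: x | x in A].

Definition minkowski_add (V : lmodType R) (A C : set V) : set V :=
  [set x + y | x in A & y in C].

Section MinkowskiMonoid.
Variable V : lmodType R.

Lemma minkowski_addA : associative (@minkowski_add V).
Proof.
move=> A C D; apply/seteqP; split => [_ [x Ax [_ [y Cy [z Dz <-]] <-]]|].
  by exists (x + y); [exists x => //; exists y | exists z => //; rewrite addrA].
move=> _ [_ [x Ax [y Cy <-]] [z Dz <-]].
by exists x => //; exists (y + z); [exists y => //; exists z | rewrite addrA].
Qed.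

Lemma minkowski_addC : commutative (@minkowski_add V).
Proof.
by move=> A C; apply/seteqP; split => _ [x ? [y ? <-]];
  exists y => //; exists x => //; rewrite addrC.
Qed.

Lemma minkowski_add0 : left_id [set 0] (@minkowski_add V).
Proof.
move=> A; apply/seteqP; split => [_ [_ -> [y Ay <-]]|y Ay]; first by rewrite add0r.
by exists 0 => //; exists y => //; rewrite add0r.
Qed.

HB.instance Definition _ := Monoid.isComLaw.Build (set V) [set 0]
  (@minkowski_add V) minkowski_addA minkowski_addC minkowski_add0.

End MinkowskiMonoid.

(* The convex hull of the basis vectors e_i, ..., e_j of R^n. *)
Definition Delta (n : nat) (i j : 'I_n) : set 'rV[R]_n :=
  convex_hull [set delta_mx 0 k | k in [set k : 'I_n | (i <= k <= j)%N]].

Definition N_PQ d (P : finPOrderType d) (r : nat) (q : 'I_r -> P) :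
    set 'rV[R]_r.+1 :=
  \big[@minkowski_add 'rV[R]_r.+1 / [set 0]]_(i < r.+1)
  \big[@minkowski_add 'rV[R]_r.+1 / [set 0]]_(j < r.+1 | (i <= j)%N)
    dilate #|B_PQ q i j| (Delta i j).

Definition lattice_points (n : nat) (N : set 'rV[R]_n) : set 'rV[int]_n :=
  [set z | N (map_mx (intr : int -> R) z)].

End Polytopes.
Arguments N_PQ R {d P r} q.

(* Main.v *)
(* An element p of hat P lies in B_{i,j} exactly when i - 1 counts the q_k below
   p and j - 1 counts the q_k not above p.  A linear extension s cuts hat P into
   r + 1 blocks, p being in block b(p) = 1 + #{k | s(q_k) < s(p)}.
   The gap vector lists the sizes of the blocks, and i <= b(p) <= j for p in B_{i,j}, so
   that the gap vector is the sum over p of the vertices e_{b(p)} of Delta_[i,j].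
   Conversely, evaluating the linear functionals x |-> \sum_(k in S) x_k on N_PQ
   shows that a lattice point satisfies Hall's condition, which yields blocks of
   the prescribed sizes with p in a block between i and j.  Exchanging elements
   makes b order preserving, and then a linear extension listing the blocks in
   order, with q_k last in block k, realizes the lattice point. *)

Require Import Defs.
From mathcomp Require Import boolp classical_sets reals convex.
From mathcomp Require Import interval_inference unstable.
From mathcomp Require Import all_boot all_order all_algebra.
From mathcomp Require Import perm zify.

Set Implicit Arguments.
Unset Strict Implicit.
Unset Printing Implicit Defensive.

Import Order.TTheory GRing.Theory Num.Theory.

Local Open Scope ring_scope.

(* Hall's marriage theorem with capacities, following Rado: if I p contains
   x <> y, one of them can be removed from I p, as otherwise two tight sets S1
   and S2 would contradict supermodularity of S |-> #{p | I p \subset S}. *)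
Lemma rado_selection (T K : finType) (I : T -> {set K}) (z : K -> int) :
    (forall S : {set K}, \sum_p (I p \subset S)%:Z <= \sum_(k in S) z k) ->
  exists b : T -> K,
    (forall p, b p \in I p) /\ (forall k, \sum_p (b p == k)%:Z <= z k).
Proof.
have [n] := ubnP (\sum_p #|I p|)%N.
elim: n => // n IHn in I *; rewrite ltnS => leIn hall.
have I_gt0 p : (0 < #|I p|)%N.
  rewrite card_gt0; apply: contraT; rewrite negbK => /eqP Ip0.
  have := hall set0; rewrite big_set0 (bigD1 p)//= Ip0 sub0set leNgt.
  by rewrite ltr_pwDl// sumr_ge0.
have [/existsP[p Ip_gt1]|/existsPn I_le1] := boolP [exists p, (1 < #|I p|)%N].
  have shrink x : x \in I p ->
      let J := fun p' => if p' == p then I p :\ x else I p' in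
      (exists b : T -> K,
        (forall p, b p \in I p) /\ (forall k, \sum_p (b p == k)%:Z <= z k)) \/
      exists S : {set K}, [/\ I p :\ x \subset S, x \notin S &
        \sum_(k in S) z k <= \sum_p (I p \subset S)%:Z].
    move=> xI J.
    have [/forallP hallJ|/forallPn[S]] := boolP [forall S : {set K},
        \sum_p (J p \subset S)%:Z <= \sum_(k in S) z k].
      left; have [|b [bJ bz]] := IHn J _ hallJ.
        apply: leq_trans leIn.
        rewrite (bigD1 p)//= [X in (_ < X)%N](bigD1 p)//=.
        rewrite [J p]/J eqxx (cardsD1 x (I p)) xI add1n addSn ltnS.
        rewrite leq_add2l leq_sum// => p' /negPf p'p.
        by rewrite /J p'p.
      exists b; split=> // p'; move: (bJ p'); rewrite /J.
      by case: eqP => // -> /setD1P[].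
    (* Only the summand at [p] differs between [J] and [I], so a violation by [S] means that [S]
       contains [I p :\ x] but not [x]. The excess over [I] is then just 1, and by integrality [S]
       is tight for [I]. *)
    rewrite -ltNge => ltS; right; exists S.
    move: ltS (hall S).
    rewrite (bigD1 p)//= [X in X <= _ -> _](bigD1 p)//= [J p]/J eqxx.
    rewrite [X in _ + X](eq_bigr (fun p => (I p \subset S)%:Z)); last first.
      by move=> p' /negPf p'p; rewrite /J p'p.
    rewrite (bigD1 p (P := predT))//=.
    have [sJS|_] := boolP (I p :\ x \subset S); last first.
      rewrite add0r => lt1 /le_lt_trans/(_ lt1).
      by rewrite gtrDr ltNge.
    have [sIS|nIS] := boolP (I p \subset S).
      by move=> lt1 /le_lt_trans/(_ lt1); rewrite ltxx.
    move=> ltS _; split=> //.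
      apply: contra nIS => xS; rewrite -(setD1K xI) subUset sub1set xS.
      exact: sJS.
    by rewrite add0r -ltzD1 addrC.
  have /card_gt1P[x [y [xI yI xy]]] := Ip_gt1.
  have [//|[S1 [IS1 xS1 tS1]]] := shrink x xI.
  have [//|[S2 [IS2 yS2 tS2]]] := shrink y yI.
  have := lerD tS1 tS2; rewrite leNgt; case/negP.
  have -> : \sum_(k in S1) z k + \sum_(k in S2) z k =
      \sum_(k in S1 :&: S2) z k + \sum_(k in S1 :|: S2) z k.
    rewrite [X in X + _](big_setID S2)/= [X in _ = _ + X](big_setID S2)/=.
    by rewrite setIUl setIid (setUidPr (subsetIr _ _)) setDUl setDv setU0
      addrAC addrA.
  apply: lt_le_trans (lerD (hall _) (hall _)).
  (* The summand at [p] makes supermodularity strict: neither [S1] nor [S2] contains [I p], but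
     their union does since [x != y]. *)
  rewrite -!big_split/= (bigD1 p)//= [X in _ < X](bigD1 p)//=.
  apply: ltr_leD.
    have -> : (I p \subset S1) = false.
      by apply: contraNF xS1 => /subsetP; apply.
    have -> : (I p \subset S2) = false.
      by apply: contraNF yS2 => /subsetP; apply.
    have -> : I p \subset S1 :|: S2.
      apply/subsetP => k kI; rewrite inE; have [->|kx] := eqVneq k x.
        by rewrite orbC (subsetP IS2)// !inE xy.
      by rewrite (subsetP IS1)// !inE kx.
    by rewrite addr0 ltr_wpDl.
  apply: ler_sum => p' _; rewrite subsetI.
  have sU1 : I p' \subset S1 -> I p' \subset S1 :|: S2.
    by move=> sS1; apply: subset_trans sS1 (subsetUl _ _).
  have sU2 : I p' \subset S2 -> I p' \subset S1 :|: S2.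
    by move=> sS2; apply: subset_trans sS2 (subsetUr _ _).
  case: (boolP (I p' \subset S1)) sU1 => [_ /(_ isT)->|_ _].
    by case: (I p' \subset S2).
  by case: (boolP (I p' \subset S2)) sU2 => [_ /(_ isT)->|_ _]//;
    rewrite addr_ge0.
(* Once every [I p] is a singleton, [b] is forced and Hall's condition at [[set k]] is the capacity
   bound. *)
have /fin_all_exists[b bI] p : exists k, I p = [set k].
  apply/cards1P; rewrite eqn_leq I_gt0 andbT leqNgt; exact: I_le1.
exists b; split=> [p|k]; first by rewrite bI set11.
have := hall [set k]; rewrite big_set1; apply: le_trans.
by apply: ler_sum => p _; rewrite bI sub1set inE.
Qed.

(** * Counting, and initial segments of ['I_r] *)

Lemma sum_boolE (T : finType) (A : pred T) :
  \sum_p (A p)%:Z = #|[set p | A p]|%:Z.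
Proof.
rewrite -sum1_card [in RHS]big_mkcond (big_morph Posz PoszD (erefl _)).
by apply: eq_bigr => p _; rewrite inE; case: (A p).
Qed.

Lemma card_ord_lt (n m : nat) : (m <= n)%N -> #|[set i : 'I_n | (i < m)%N]| = m.
Proof.
move=> mn; rewrite -sum1_card -[RHS](card_ord m) -sum1_card.
by rewrite (big_ord_widen n (fun=> 1%N) mn); apply: eq_bigl => i; rewrite inE.
Qed.

Section InitialSegments.
Variable r : nat.

Definition seg_size (A : {set 'I_r}) : 'I_r.+1 := inord #|A|.

Lemma seg_sizeE (A : {set 'I_r}) : seg_size A = #|A| :> nat.
Proof. by rewrite inordK// ltnS -[leqRHS]card_ord max_card. Qed.

Lemma seg_sizeS (A B : {set 'I_r}) :
  A \subset B -> (seg_size A <= seg_size B)%N.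
Proof. by rewrite !seg_sizeE; exact: subset_leq_card. Qed.

(** A down-closed subset of a chain is determined by its size; this turns comparisons with the [q i]
    into inequalities between numbers. *)
Lemma mem_seg (A : {set 'I_r}) :
  (forall i j : 'I_r, (i <= j)%N -> j \in A -> i \in A) ->
  forall i : 'I_r, (i \in A) = (i < seg_size A)%N.
Proof.
move=> Adown i; rewrite seg_sizeE; apply/idP/idP => [iA|].
  rewrite -[leqLHS](card_ord_lt (ltn_ord i));
    apply/subset_leq_card/subsetP => j.
  by rewrite inE ltnS => /Adown; apply.
apply: contraTT => iA;
  rewrite -leqNgt -[leqRHS](card_ord_lt (ltnW (ltn_ord i))).
apply/subset_leq_card/subsetP => j jA; rewrite inE ltnNge.
by apply: contra iA => /Adown; apply.
Qed.

End InitialSegments.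

(** * Linear extensions and monotone maps on a finite poset *)

Section Posets.
Context d (X : finPOrderType d).

Lemma card_below_lt (x y : X) :
  (x < y)%O -> (#|[set z : X | (z <= x)%O]| < #|[set z : X | (z <= y)%O]|)%N.
Proof.
move=> xy; apply/proper_card/properP; split.
  by apply/subsetP => z; rewrite !inE => /le_trans; apply; exact: ltW.
by exists y; rewrite !inE ?lexx// lt_geF.
Qed.

Lemma rank_of_injective_key (key : X -> nat) : injective key ->
  exists2 s : X -> 'I_#|X|, bijective s &
    forall x y, (key x < key y)%N -> (s x < s y)%N.
Proof.
move=> key_inj; pose A x := [set y | (key y < key x)%N].
have ltA x : (#|A x| < #|X|)%N.
  rewrite -cardsT; apply/proper_card/properP; split; first exact: subsetT.
  by exists x; rewrite ?inE ?ltnn.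
pose s x := Ordinal (ltA x).
have s_mono x y : (key x < key y)%N -> (s x < s y)%N.
  move=> xy; apply/proper_card/properP; split.
    by apply/subsetP => z; rewrite !inE => /ltn_trans; apply.
  by exists x; rewrite !inE ?ltnn.
exists s => //; apply: inj_card_bij; last by rewrite card_ord.
move=> x y sxy; apply: key_inj; apply/eqP; apply: contraT.
by rewrite neq_ltn => /orP[] /s_mono; rewrite sxy ltnn.
Qed.

(* Ties of f are broken by the number of elements below, and then arbitrarily. *)
Lemma linear_extension_refining (f : X -> nat) :
  {homo f : x y / (x < y)%O >-> (x <= y)%N} ->
  exists2 s : X -> 'I_#|X|, linear_extension s &
    forall x y, (f x < f y)%N -> (s x < s y)%N.
Proof.
move=> f_homo; pose N := #|X|.+1; pose h x := #|[set z : X | (z <= x)%O]|.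
(* In base [N] the last two digits are [h x] and [enum_rank x], both below [N], so keys compare
   lexicographically. *)
pose key x := ((f x * N + h x) * N + enum_rank x)%N.
have digit a a' c c' : (a < a')%N -> (c < N)%N -> (a * N + c < a' * N + c')%N.
  move=> aa' cN; apply: (@leq_trans (a.+1 * N)); last first.
    by rewrite -[leqLHS]addn0 leq_add// leq_mul2r aa' orbT.
  by rewrite mulSn addnC ltn_add2r.
have hN x : (h x < N)%N by rewrite ltnS max_card.
have eN (x : X) : (enum_rank x < N)%N by exact: leq_trans (ltn_ord _) (leqnSn _).
have keyf x y : (f x < f y)%N -> (key x < key y)%N.
  by move=> fxy; apply: (digit) => //; exact: digit.
have key_inj : injective key.
  move=> x y /(congr1 (modn^~ N)); rewrite !modnMDl !modn_small//.
  by move=> /val_inj/enum_rank_inj.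
have [s s_bij s_key] := rank_of_injective_key key_inj.
exists s => [|x y fxy]; last by apply: s_key; exact: keyf.
split=> // x y xy; apply: s_key.
have [fxy|fxy|fxy] := ltngtP (f x) (f y); first exact: keyf.
  by have := f_homo _ _ xy; rewrite leqNgt fxy.
by apply: digit => //; rewrite fxy ltn_add2l; exact: card_below_lt.
Qed.

(* Exchanging the values of b at x < y with b x > b y respects the constraints
   and increases the sum of the b x weighted by the sizes of the down-sets, so
   an assignment maximizing this sum is monotone. *)
Lemma monotone_rearrangement n (lo hi b0 : X -> 'I_n) :
  {homo lo : x y / (x < y)%O >-> (x <= y)%N} ->
  {homo hi : x y / (x < y)%O >-> (x <= y)%N} ->
  (forall x, (lo x <= b0 x <= hi x)%N) ->
  exists b : X -> 'I_n,
    [/\ {homo b : x y / (x < y)%O >-> (x <= y)%N},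
        forall x, (lo x <= b x <= hi x)%N &
        forall k, \sum_x (b x == k)%:Z = \sum_x (b0 x == k)%:Z].
Proof.
move=> lo_homo hi_homo b0P; pose h x := #|[set z : X | (z <= x)%O]|.
pose good (b : {ffun X -> 'I_n}) := [forall x, lo x <= b x <= hi x]%N &&
  [forall k, \sum_x (b x == k)%:Z == \sum_x (b0 x == k)%:Z].
have good0 : good [ffun x => b0 x].
  apply/andP; split; apply/forallP => x; first by rewrite ffunE b0P.
  by apply/eqP/eq_bigr => y _; rewrite ffunE.
pose weight (b : {ffun X -> 'I_n}) := (\sum_x b x * h x)%N.
have [b /andP[/forallP bP /forallP bz] bmax] := @arg_maxnP _ _ good weight good0.
exists b; split=> // [x y xy|k]; last exact/eqP.
rewrite leqNgt; apply/negP => byx.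
pose t := tperm x y; pose b' := [ffun z => b (t z)].
have /andP[lox hix] := bP x; have /andP[loy hiy] := bP y.
have loxy := lo_homo _ _ xy; have hixy := hi_homo _ _ xy.
have /bmax : good b'.
  apply/andP; split; apply/forallP => z; last first.
    rewrite -(eqP (bz z)) [X in _ == X](reindex_inj (@perm_inj _ t))/=.
    by apply/eqP/eq_bigr => u _; rewrite ffunE.
  (* The chain [lo x <= lo y <= b y < b x <= hi x <= hi y] keeps both exchanged values within
     bounds. *)
  rewrite ffunE /t; case: tpermP => [->|->|_ _]; last exact: bP.
    by rewrite (leq_trans loxy loy) (leq_trans (ltnW byx) hix).
  by rewrite (leq_trans loy (ltnW byx)) (leq_trans hix hixy).
apply/negP; rewrite -ltnNge /weight.
have yx : y != x by rewrite gt_eqF.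
rewrite (bigD1 x)//= (bigD1 y)//= [X in (_ < X)%N](bigD1 x)//=.
rewrite [X in (_ < _ + X)%N](bigD1 y)//= !ffunE tpermL tpermR !addnA.
rewrite [X in (_ < _ + X)%N](eq_bigr (fun z => b z * h z)%N); last first.
  by move=> z /andP[zx zy]; rewrite ffunE tpermD// eq_sym.
(* This is [(a' - a) * (c' - c) > 0] expanded. *)
have rearrange a a' c c' : (a < a')%N -> (c < c')%N ->
  (a' * c + a * c' < a * c + a' * c')%N by nia.
by rewrite ltn_add2r; apply: rearrange byx (card_below_lt xy).
Qed.

End Posets.

#[local] Arguments qhat : simpl never.

(** * The intervals [[lo p, hi p]] cut out by the chain, and blocks of linear extensions *)

Section Chain.
Context d (P : finPOrderType d) (r : nat) (q : 'I_r -> P).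

Lemma qhatS (i : 'I_r) : qhat q i.+1 = HatIn (q i).
Proof. by rewrite /qhat /with_ends valK. Qed.

Lemma qhat_top : qhat q r.+1 = HatTop.
Proof. by rewrite /qhat /with_ends insubF ?ltnn. Qed.

Hypothesis q_chain : {homo q : i j / (i < j)%N >-> (i < j)%O}.

(* As in B_PQ, blocks are numbered from 0: the block k of 'I_r.+1 ends at q k. *)
Definition lo (p : hat P) : 'I_r.+1 := seg_size [set i | (HatIn (q i) < p)%O].
Definition hi (p : hat P) : 'I_r.+1 :=
  seg_size [set i | ~~ (p <= HatIn (q i))%O].

Lemma HatInq_le (i j : 'I_r) :
  (i <= j)%N -> (HatIn (q i) <= HatIn (q j) :> hat P)%O.
Proof.
by rewrite leq_eqVlt => /predU1P[/val_inj->//|/q_chain/ltW].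
Qed.

Lemma lt_lo (i : 'I_r) p : (HatIn (q i) < p)%O = (i < lo p)%N.
Proof.
rewrite -mem_seg ?inE// => j k jk; rewrite !inE; exact/le_lt_trans/HatInq_le.
Qed.

Lemma hi_le (i : 'I_r) p : (p <= HatIn (q i))%O = (hi p <= i)%N.
Proof.
rewrite leqNgt -mem_seg ?inE ?negbK// => j k jk; rewrite !inE.
by apply: contra => pqj; apply: le_trans pqj (HatInq_le jk).
Qed.

Lemma lo_le_hi p : (lo p <= hi p)%N.
Proof. by apply/seg_sizeS/subsetP => i; rewrite !inE => /lt_geF->. Qed.

Lemma lo_homo : {homo lo : x y / (x < y)%O >-> (x <= y)%N}.
Proof.
move=> x y xy; apply/seg_sizeS/subsetP => i; rewrite !inE => /lt_trans.
exact.
Qed.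

Lemma hi_homo : {homo hi : x y / (x < y)%O >-> (x <= y)%N}.
Proof.
move=> x y xy; apply/seg_sizeS/subsetP => i; rewrite !inE.
by apply: contra => /(lt_le_trans xy)/ltW.
Qed.

Lemma lo_q (i : 'I_r) : lo (HatIn (q i)) = i :> nat.
Proof.
apply/eqP; rewrite eqn_leq leqNgt -lt_lo ltxx/= leqNgt; apply/negP => loi.
have lor := ltn_trans loi (ltn_ord i).
have : (HatIn (q (Ordinal lor)) < HatIn (q i))%O.
  rewrite lt_neqAle HatInq_le 1?ltnW// andbT.
  have qlt : (q (Ordinal lor) < q i)%O by exact: q_chain.
  by apply: contraTneq qlt => -[->]; rewrite ltxx.
by rewrite lt_lo ltnn.
Qed.

Lemma hi_q (i : 'I_r) : hi (HatIn (q i)) = i :> nat.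
Proof.
apply/eqP; rewrite eqn_leq -hi_le lexx/=.
by have := lo_le_hi (HatIn (q i)); rewrite lo_q.
Qed.

(** The index 0 is excluded because [qhat q 0] is the bottom, which is not below itself. *)
Lemma lt_qhat (i : 'I_r.+1) p : (0 < i)%N -> (qhat q i < p)%O = (i <= lo p)%N.
Proof.
case: i => [[//|i] iP] _ /=; rewrite ltnS in iP.
by rewrite (qhatS (Ordinal iP)) lt_lo.
Qed.

Lemma le_qhat (j : 'I_r.+1) p : (p <= qhat q j.+1)%O = (hi p <= j)%N.
Proof.
have [jr|jr] := ltnP j r; first by rewrite (qhatS (Ordinal jr)) hi_le.
have -> : j = r :> nat by apply/eqP; rewrite eqn_leq jr -ltnS ltn_ord.
by rewrite qhat_top -ltnS ltn_ord; exact: lex1.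
Qed.

(** Thus the sets [B_PQ q i j] with [i <= j] are the fibres of [(lo, hi)] and partition [hat P]. The
    non-strict lower bound at [ord0] accounts for the bottom element. *)
Lemma mem_B_PQ (i j : 'I_r.+1) p :
  (i <= j)%N -> (p \in B_PQ q i j) = (lo p == i) && (hi p == j).
Proof.
move=> ij; rewrite /B_PQ -!(inj_eq val_inj)/=; have lohi := lo_le_hi p.
case: ifPn => [/eqP ji|inj].
  case: ifPn => [/eqP i0|i0]; rewrite inE -?ji.
    rewrite i0 (le_qhat ord0) leqn0; apply/idP/andP => [/eqP hi0|[]//].
    by move: lohi; rewrite hi0 leqn0 => ->.
  rewrite lt_qhat ?lt0n// le_qhat; apply/andP/andP => -[].
    move=> ilo hii; rewrite !eqn_leq ilo hii.
    by rewrite (leq_trans lohi hii) (leq_trans ilo lohi).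
  by move=> /eqP-> /eqP->; rewrite !leqnn.
have {ij inj} ij : (i < j)%N by rewrite ltn_neqAle inj.
have ir : (i < r)%N by rewrite (leq_trans ij)// -ltnS.
have iE : i = Ordinal ir :> nat by [].
have jE : j = (inord j.-1 : 'I_r.+1).+1 :> nat.
  have j_gt0 : (0 < j)%N by exact: leq_ltn_trans ij.
  by rewrite inordK prednK// ltnW.
have le_qhatj : (p <= qhat q j)%O = (hi p < j)%N.
  by rewrite [X in qhat q X]jE le_qhat [in RHS]jE ltnS.
rewrite inE le_qhatj -leqNgt; apply/and3P/andP.
  move=> [/andP[ip /ltW]]; rewrite le_qhat => hij ipN jhi.
  have loi : (lo p <= i)%N.
    by rewrite leqNgt -(lt_lo (Ordinal ir)) -qhatS (contra (@ltW _ _ _ _) ipN).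
  split; rewrite eqn_leq ?hij// loi/=.
  by have [->//|i0] := posnP i; rewrite -lt_qhat.
move=> [/eqP loi /eqP hij]; split; last by rewrite hij.
  apply/andP; split.
    have [i0|i0] := posnP i; last by rewrite lt_qhat// loi.
    rewrite i0 lt_neqAle le0x andbT; apply: contraTneq ij => p0.
    by have := le_qhatj; rewrite hij ltnn -p0 le0x.
  (* If [p] were the upper end, then [lo p] would be [j] for [j < r], and for [j = r] the top would
     lie above [q i]; both contradict [lo p = i < j]. *)
  rewrite lt_neqAle le_qhat hij leqnn andbT; apply/eqP => pE.
  have [jr|jr] := ltnP j r.
    have := loi; rewrite pE (qhatS (Ordinal jr)) lo_q /=; lia.
  have jr' : j = r :> nat by apply/eqP; rewrite eqn_leq jr -ltnS ltn_ord.
  have : (HatIn (q (Ordinal ir)) < p)%O by rewrite pE jr' qhat_top.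
  by rewrite lt_lo loi ltnn.
rewrite iE qhatS le_eqVlt negb_or lt_lo loi ltnn andbT.
by apply: contraTneq ij => pE; rewrite -hij -pE hi_q ltnn.
Qed.

Lemma sum_B_PQ (V : nmodType) (F : hat P -> V) :
  \sum_(i < r.+1) \sum_(j < r.+1 | (i <= j)%N) \sum_(p in B_PQ q i j) F p =
  \sum_p F p.
Proof.
rewrite [RHS](partition_big lo predT)//=; apply: eq_bigr => i _.
rewrite [RHS](partition_big hi (fun j : 'I_r.+1 => (i <= j)%N)) => [|p /eqP<-]/=.
  by apply: eq_bigr => j ij; apply: eq_bigl => p; rewrite mem_B_PQ.
exact: lo_le_hi.
Qed.

Lemma sum_B_PQ_const (V : nmodType) (c : 'I_r.+1 -> 'I_r.+1 -> V) :
  \sum_(i < r.+1) \sum_(j < r.+1 | (i <= j)%N) c i j *+ #|B_PQ q i j| =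
  \sum_p c (lo p) (hi p).
Proof.
rewrite -sum_B_PQ; apply: eq_bigr => i _; apply: eq_bigr => j ij.
rewrite -sumr_const; apply: eq_bigr => p.
by rewrite mem_B_PQ// => /andP[/eqP-> /eqP->].
Qed.

(** The label of the m-th chain element counts the elements of the first m blocks, and successive
    differences count single blocks. *)
Lemma gap_vectorE (s : hat P -> 'I_#|hat P|) (b : hat P -> 'I_r.+1) :
  bijective s ->
  (forall i p, (s (HatIn (q i)) < s p)%N = (i < b p)%N) ->
  forall k, gap_vector P (\row_i ((s (HatIn (q i))).+1)%:Z) 0 k =
    \sum_p (b p == k)%:Z.
Proof.
move=> s_bij sb k; rewrite mxE.
set c := (\row_i _) 0.
have cE m : (m <= r.+1)%N ->
    with_ends 0 (#|hat P|)%:Z c m = \sum_p (b p < m)%N%:Z.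
  case: m => [_|m]; first by rewrite big1.
  rewrite ltnS leq_eqVlt => /predU1P[->|mr] /=.
    rewrite insubF ?ltnn// (eq_bigr (fun=> 1)) => [|p _];
      last by rewrite ltn_ord.
    by rewrite sumr_const natz.
  rewrite insubT /c mxE.
  set a := s _.
  transitivity (\sum_(x < #|hat P|) (x < a.+1)%N%:Z).
    by rewrite sum_boolE card_ord_lt.
  rewrite (reindex s)/=; last exact: onW_bij.
  by apply: eq_bigr => p _; rewrite !ltnS leqNgt sb -leqNgt.
rewrite (cE k) 1?ltnW// cE// -sumrB; apply: eq_bigr => p _.
rewrite ltnS leq_eqVlt -(inj_eq val_inj)/=.
by case: ltngtP.
Qed.

(** Doubling [b] in the sorting key leaves room to move a chain element behind the rest of its block
    without reaching the next block. *)
Lemma linear_extension_of_blocks (b : hat P -> 'I_r.+1) :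
  {homo b : x y / (x < y)%O >-> (x <= y)%N} ->
  (forall p, (lo p <= b p <= hi p)%N) ->
  exists2 s : hat P -> 'I_#|hat P|, linear_extension s &
    forall i p, (s (HatIn (q i)) < s p)%N = (i < b p)%N.
Proof.
(* The summand p == q_(b p) puts q_k last in its block. *)
move=> b_homo bP; pose f p := ((b p).*2 + (p == qhat q (b p).+1))%N.
have b_q i : b (HatIn (q i)) = i :> nat.
  by have := bP (HatIn (q i)); rewrite lo_q hi_q -eqn_leq => /eqP.
have f_q i : f (HatIn (q i)) = i.*2.+1.
  by rewrite /f b_q qhatS eqxx addn1.
have f_homo : {homo f : x y / (x < y)%O >-> (x <= y)%N}.
  move=> x y xy; have := b_homo _ _ xy.
  rewrite /f leq_eqVlt => /predU1P[/val_inj bxy|bxy]; last first.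
    by apply: leq_trans (leq_addr _ _); case: (x == _); lia.
  rewrite -bxy leq_add2l; case: eqP => // xq.
  (* Here [x] ends its block, so [y] above it has [b x < lo y <= b y]; in the last block [x] would
     be the top, with nothing above. *)
  have [br|br] := ltnP (b x) r.
    have := bP y; rewrite -bxy => /andP[+ _]; rewrite leqNgt.
    by rewrite -(lt_lo (Ordinal br)) -qhatS -xq xy.
  have bxr : b x = r :> nat by apply/eqP; rewrite eqn_leq br -ltnS ltn_ord.
  by move: xy; rewrite xq bxr qhat_top => /lt_geF; rewrite lex1.
have [s s_ext s_f] := linear_extension_refining f_homo.
exists s => // i p; have [ib|bi] := ltnP i (b p).
  by apply: s_f; rewrite f_q /f; lia.
have [->|pq] := eqVneq p (HatIn (q i)); first by rewrite ltnn.
apply/negbTE; rewrite -leqNgt ltnW//; apply: s_f; rewrite f_q /f ltnS.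
move: bi; rewrite leq_eqVlt => /predU1P[bi|bi]; last by case: (p == _); lia.
by rewrite bi qhatS (negPf pq) addn0.
Qed.

End Chain.

Local Open Scope classical_set_scope.

(** * Points of Minkowski sums of dilated simplices, and linear functionals on them *)

Section Polytopes.
Context {R : realType}.

Lemma convex_hull_convex (V : lmodType R) (A : set V) :
  convex_set (convex_hull A).
Proof.
move=> x y t /set_mem xA /set_mem yA; apply/mem_set => B [Bc AB].
by apply/set_mem/Bc; apply/mem_set; [apply: xA|apply: yA].
Qed.

(** The point [m a + n b] is [m + n] times the convex combination with weights [m / (m + n)] and
    [n / (m + n)]; if [m + n = 0], any point of [A] serves. *)
Lemma dilateD (V : lmodType R) (A : set V) (m n : nat) (x y : V) :
  convex_set A -> dilate m A x -> dilate n A y -> dilate (m + n) A (x + y).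
Proof.
move=> Ac [a Aa <-] [b Ab <-].
have [/eqP mn0|mn0] := eqVneq (m + n)%N 0%N.
  exists a => //; move: mn0; rewrite addn_eq0 => /andP[/eqP-> /eqP->].
  by rewrite !scale0r addr0.
have mnR0 : (m + n)%:R != 0 :> R by rewrite pnatr_eq0.
have t0 : 0 <= m%:R / (m + n)%:R :> R by rewrite divr_ge0.
have t1 : m%:R / (m + n)%:R <= 1 :> R.
  by rewrite ler_pdivrMr ?ltr0n ?lt0n// mul1r ler_nat leq_addr.
exists (conv (Itv01 t0 t1) (a : convex_lmodType V) b).
  by apply/set_mem/Ac; apply/mem_set.
rewrite [conv _ _ _]/conv/= scalerDr !scalerA mulrC divfK//; congr (_ + _ *: _).
by rewrite /onem mulrBr mulr1 mulrCA divff// mulr1 natrD addrAC subrr add0r.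
Qed.

(** Nonemptiness of [A] covers the empty [B]: [dilate 0 A] contains 0 only if [A] has a point. *)
Lemma dilate_sum (V : lmodType R) (A : set V) (I : finType) (B : {set I})
    (F : I -> V) :
  convex_set A -> A !=set0 -> (forall p, p \in B -> A (F p)) ->
  dilate #|B| A (\sum_(p in B) F p).
Proof.
move=> Ac [a Aa] AF; rewrite -sum1_card.
elim/big_rec2: _ => [|p n x pB IH]; first by exists a => //; rewrite scale0r.
rewrite addrC [X in dilate X](addnC 1%N); apply: dilateD => //.
by exists (F p); rewrite ?scale1r//; exact: AF.
Qed.

Lemma minkowski_sum (V : lmodType R) (I : Type) (s : seq I) (Q : pred I)
    (A : I -> set V) (F : I -> V) :
  (forall i, Q i -> A i (F i)) ->
  (\big[@minkowski_add R V / [set 0]]_(i <- s | Q i) A i)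
    (\sum_(i <- s | Q i) F i).
Proof.
move=> AF; elim/big_rec2: _ => [//|i x X Qi Xx].
by exists (F i); [exact: AF | exists x].
Qed.

Section Functional.
Variables (n : nat) (w : 'I_n -> R).
Let L (x : 'rV[R]_n) := \sum_k w k * x 0 k.

Let L0 : L 0 = 0.
Proof. by rewrite /L big1// => k _; rewrite mxE mulr0. Qed.

Let LD x y : L (x + y) = L x + L y.
Proof.
by rewrite /L -big_split; apply: eq_bigr => k _; rewrite mxE mulrDr.
Qed.

Let LZ a x : L (a *: x) = a * L x.
Proof.
by rewrite /L big_distrr; apply: eq_bigr => k _; rewrite /= mxE mulrCA.
Qed.

(** The half-space where the functional is at least [c] is convex and contains the vertices, hence
    the hull. *)
Lemma Delta_ge (c : R) (i j : 'I_n) (x : 'rV[R]_n) :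
  (forall k : 'I_n, (i <= k <= j)%N -> c <= w k) -> Delta i j x ->
  c <= \sum_k w k * x 0 k.
Proof.
move=> cw /(_ [set x | c <= L x]); apply; split=> [y z t|_ [k /= ikj <-]].
  move=> /set_mem/= yc /set_mem/= zc; apply/mem_set => /=.
  rewrite [conv _ _ _]/conv/= LD !LZ.
  rewrite -[leLHS]mul1r -[X in X * _](add_onemK t%:num) mulrDl.
  by apply: lerD; apply: ler_wpM2l; rewrite ?onem_ge0.
rewrite /= /L (bigD1 k)//= mxE !eqxx mulr1 big1 ?addr0 ?cw// => l lk.
by rewrite mxE eqxx (negPf lk) mulr0.
Qed.

Lemma minkowski_sum_ge (I : Type) (s : seq I) (Q : pred I)
    (A : I -> set 'rV[R]_n) (c : I -> R) x :
  (forall i x, Q i -> A i x -> c i <= \sum_k w k * x 0 k) ->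
  (\big[@minkowski_add R 'rV[R]_n / [set 0]]_(i <- s | Q i) A i) x ->
  \sum_(i <- s | Q i) c i <= \sum_k w k * x 0 k.
Proof.
rewrite -/(L x) => cA; elim/big_rec2: _ x => [x ->|i a X Qi IH x].
  by rewrite L0.
by move=> [y Ay [z Xz <-]]; rewrite LD lerD ?IH//; exact: (cA i).
Qed.

Lemma dilate_ge (m : nat) (A : set 'rV[R]_n) c x :
  (forall x, A x -> c <= \sum_k w k * x 0 k) -> dilate m A x ->
  c *+ m <= \sum_k w k * x 0 k.
Proof.
move=> cA [y Ay <-]; rewrite -/(L _) LZ -[leLHS]mulr_natl ler_wpM2l//;
  exact: cA.
Qed.

End Functional.

Section N.
Context d (P : finPOrderType d) (r : nat) (q : 'I_r -> P).

(** Lower bounds on the simplices add up over the Minkowski sum. This yields both Hall's condition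
    and the bound on the coordinate sum. *)
Lemma N_PQ_ge (w : 'I_r.+1 -> R) (c : 'I_r.+1 -> 'I_r.+1 -> R)
    (x : 'rV[R]_r.+1) :
  (forall i j k : 'I_r.+1, (i <= k <= j)%N -> c i j <= w k) ->
  N_PQ R q x ->
  \sum_(i < r.+1) \sum_(j < r.+1 | (i <= j)%N) c i j *+ #|B_PQ q i j| <=
    \sum_k w k * x 0 k.
Proof.
move=> cw; apply: minkowski_sum_ge => /= i {}x _.
apply: minkowski_sum_ge => /= j {}x ij.
by apply: dilate_ge => {}x; apply: Delta_ge => k; exact: cw.
Qed.

Lemma N_PQ_sum (b : hat P -> 'I_r.+1) :
  (forall (i j : 'I_r.+1) p, (i <= j)%N -> p \in B_PQ q i j ->
    (i <= b p <= j)%N) ->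
  N_PQ R q (\sum_(i < r.+1) \sum_(j < r.+1 | (i <= j)%N)
    \sum_(p in B_PQ q i j) delta_mx 0 (b p)).
Proof.
move=> bB; apply: minkowski_sum => i _; apply: minkowski_sum => j ij.
have D (k : 'I_r.+1) : (i <= k <= j)%N ->
      Delta i j (delta_mx 0 k : 'rV[R]_r.+1).
  by move=> ikj; apply: sub_gen_smallest; exists k.
apply: dilate_sum; first exact: convex_hull_convex.
  by exists (delta_mx 0 i); apply: D; rewrite leqnn.
by move=> p /(bB _ _ _ ij); exact: D.
Qed.

End N.
End Polytopes.

Theorem theorem3p2 (R : realType) (d : Order.disp_t) (P : finPOrderType d)
    (r : nat) (q : 'I_r -> P) (r_gt0 : (0 < r)%N)
    (q_chain : {homo q : i j / (i < j)%N >-> (i < j)%O}) :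
  M_PQ q = lattice_points (N_PQ R q).
Proof.
apply/seteqP; split => [_ [_ [s [s_bij s_homo] ->] <-]|z].
  (* [b p] is the 0-based block of [p] under [s]. *)
  pose b p := seg_size [set i | (s (HatIn (q i)) < s p)%N].
  have sb i p : (s (HatIn (q i)) < s p)%N = (i < b p)%N.
    rewrite -mem_seg ?inE// => j k; rewrite !inE leq_eqVlt.
    move=> /predU1P[/val_inj->//|jk]; apply: ltn_trans; apply: s_homo.
    by rewrite (lt_lo q_chain) (lo_q q_chain).
  have bP p : (lo q p <= b p <= hi q p)%N.
    apply/andP; split; apply/seg_sizeS/subsetP => i; rewrite !inE.
      exact: s_homo.
    apply: contraL; rewrite -leqNgt le_eqVlt => /predU1P[->//|/s_homo].
    exact: ltnW.
  have bB (i j : 'I_r.+1) p : (i <= j)%N -> p \in B_PQ q i j ->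
      (i <= b p <= j)%N.
    by move=> ij; rewrite (mem_B_PQ q_chain)// => /andP[/eqP<- /eqP<-].
  rewrite /lattice_points/=.
  have := N_PQ_sum (R := R) bB; rewrite (sum_B_PQ q_chain).
  congr (N_PQ R q _); apply/rowP => k.
  rewrite mxE (gap_vectorE s_bij sb) rmorph_sum summxE.
  by apply: eq_bigr => p _; rewrite mxE eqxx eq_sym; case: eqP.
rewrite /lattice_points/= => Nz.
pose I p := [set k : 'I_r.+1 | (lo q p <= k <= hi q p)%N]%SET.
have [b0 [b0I b0z]] : exists b : hat P -> 'I_r.+1,
    (forall p, b p \in I p) /\ (forall k, \sum_p (b p == k)%:Z <= z 0 k).
  apply: rado_selection => S.
  (* On [Delta i j] the indicator functional of [S] is at least 1 if [[i, j]] lies in [S], and at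
     least 0 otherwise. *)
  have := N_PQ_ge (w := fun k => (k \in S)%:R)
    (c := fun i j => ([set k : 'I_r.+1 | (i <= k <= j)%N]%SET \subset S)%:R) _ Nz.
  rewrite (sum_B_PQ_const q_chain) => ineq.
  rewrite -(ler_int R) !rmorph_sum [X in _ <= X]big_mkcond/=.
  apply: le_trans (le_trans (ineq _) _); last 1 first.
  - by apply: ler_sum => k _; rewrite mxE; case: (k \in S);
    rewrite ?mul1r ?mul0r.
  - by [].
  move=> i j k ikj; rewrite ler_nat; case: subsetP => // /(_ k).
  by rewrite inE ikj => ->.
have b0P p : (lo q p <= b0 p <= hi q p)%N by have := b0I p; rewrite inE.
(* Weights [-1] bound the coordinate sum of [z] by [#|hat P|], which is also the total size of the
   blocks of [b0]; so every capacity is filled. *)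
have b0E k : \sum_p (b0 p == k)%:Z = z 0 k.
  have := N_PQ_ge (w := fun=> -1) (c := fun _ _ => -1) (fun _ _ _ _ => lexx _) Nz.
  rewrite (sum_B_PQ_const q_chain).
  under [X in _ <= X]eq_bigr => i _ do rewrite mxE mulN1r.
  rewrite !sumrN lerN2 -rmorph_sum/= => tot.
  have {}tot : \sum_i z 0 i <= \sum_i \sum_p (b0 p == i)%:Z.
    rewrite exchange_big/= -(ler_int R) (le_trans tot)// rmorph_sum/= ler_sum//.
    by move=> p _;
      rewrite (bigD1 (b0 p))//= eqxx rmorphD/= lerDl ler0z sumr_ge0.
  have d_ge0 i : 0 <= z 0 i - \sum_p (b0 p == i)%:Z by rewrite subr_ge0.
  have /psumr_eq0P : \sum_i (z 0 i - \sum_p (b0 p == i)%:Z) = 0.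
    by apply/eqP; rewrite eq_le sumr_ge0 ?andbT// sumrB subr_le0.
  by move=> /(_ (fun i _ => d_ge0 i) k isT)/eqP; rewrite subr_eq0 => /eqP.
have [b [b_homo bP bE]] :=
  monotone_rearrangement (lo_homo q) (hi_homo q) b0P.
have [s s_ext sb] := linear_extension_of_blocks q_chain b_homo bP.
exists (\row_i ((s (HatIn (q i))).+1)%:Z); first by exists s.
apply/rowP => k; rewrite -b0E -bE.
by apply: gap_vectorE => //; case: s_ext.
Qed.
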